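(* Let $\Delta\subset\mathbb R^n$ be a smooth lattice polytope of dimension $n$ and let $\Gamma$ be a unimodular triangulation of $\Delta$. For every integer $k$ with $0\le k\le n$, there exists a $k$-real phase structure on $\Gamma$.
   Context: A lattice polytope is a full-dimensional convex polytope $\Delta\subset\mathbb R^n$ with vertices in $\mathbb Z^n$. For a lattice polytope or simplex $\sigma$ in $\mathbb R^n$, $T(\sigma)\subset\mathbb Z^n$ is the sublattice spanned by differences of points of $\sigma\cap\mathbb Z^n$, $T_2(\sigma)=T(\sigma)\otimes\mathbb F_2\subset\mathbb F_2^n$, and $T_2^\perp(\sigma)\subset(\mathbb F_2^n)^\vee=\operatorname{Hom}(\mathbb F_2^n,\mathbb F_2)$ is the annihilator of $T_2(\sigma)$. $\Delta$ is smooth if for each vertex $v$ one has $\mathbb Z^n=\bigoplus T(\rho)$, the sum over edges $\rho$ of $\Delta$ containing $v$. A triangulation $\Gamma$ of $\Delta$ with vertices in $\mathbb Z^n$ is unimodular if every $n$-simplex has Euclidean volume $1/n!$; $F_k(\Gamma)$ is the set of its $k$-simplices and $F_k(\tau)$ the set of $k$-faces of a simplex $\tau$. Let $\mathcal Q^n$ be an affine space directed by $(\mathbb F_2^n)^\vee$. A $k$-real phase structure on $\Gamma$ (real phase structure on the $k$-skeleton of $\Gamma$) is a choice, for each $\sigma\in F_k(\Gamma)$, of an affine subspace $\mathcal E(\sigma)\subset\mathcal Q^n$ directed by $T_2^\perp(\sigma)$ such that for every $\tau\in F_{k+1}(\Gamma)$ and every $s\in\mathcal Q^n$ the number of $\sigma\in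 F_k(\tau)$ with $s\in\mathcal E(\sigma)$ is even. *)

(* Defs.v *)
From HB Require Import structures.
From mathcomp Require Import all_boot all_order all_algebra.
From mathcomp Require Import finmap.
From mathcomp Require Import all_classical all_reals all_analysis.

Set Implicit Arguments.
Unset Strict Implicit.
Unset Printing Implicit Defensive.

Import Order.TTheory GRing.Theory Num.Theory.
Import numFieldNormedType.Exports.

Local Open Scope fset_scope.
Local Open Scope classical_set_scope.
Local Open Scope ring_scope.

Definition conv (R : realType) (n : nat) (A : set 'rV[R]_n) : set 'rV[R]_n :=
  smallest (@convex_set R 'rV[R]_n) A.

Definition affinely_independent (R : realType) (n : nat)
    (s : {fset 'rV[R]_n}) : Prop :=
  forall c : 'rV[R]_n -> R,
    \sum_(v <- s) c v = 0 -> \sum_(v <- s) c v *: v = 0 ->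
    forall v, v \in s -> c v = 0.

(* [A] is nonempty and its affine hull has dimension [d]. *)
Definition has_dimension (R : realType) (n : nat) (A : set 'rV[R]_n)
    (d : nat) : Prop :=
  (exists s : {fset 'rV[R]_n},
     [/\ [set` s] `<=` A, affinely_independent s & #|` s| = d.+1]) /\
  (forall s : {fset 'rV[R]_n},
     [set` s] `<=` A -> affinely_independent s -> (#|` s| <= d.+1)%N).

Definition polytope (R : realType) (n : nat) (P : set 'rV[R]_n) : Prop :=
  exists s : {fset 'rV[R]_n}, P = conv [set` s].

Definition dot (R : realType) (n : nat) (a x : 'rV[R]_n) : R :=
  \sum_(i < n) a 0 i * x 0 i.

(* Taking [a = 0] shows that a nonempty [P] is a face of itself. *)
Definition face (R : realType) (n : nat) (P F : set 'rV[R]_n) : Prop :=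
  F !=set0 /\
  exists (a : 'rV[R]_n) (b : R),
    (forall x, P x -> dot a x <= b) /\ F = [set x | P x /\ dot a x = b].

Definition vertex (R : realType) (n : nat) (P : set 'rV[R]_n)
    (v : 'rV[R]_n) : Prop :=
  face P [set v].

Definition edge (R : realType) (n : nat) (P E : set 'rV[R]_n) : Prop :=
  face P E /\ has_dimension E 1.

(* n-dimensional Lebesgue measure, written as an iterated integral: the
   measure of [A] is the integral of the measures of its slices at a fixed
   first coordinate.  By Tonelli this is the Lebesgue measure of any Borel [A];
   it is only applied to simplices. *)
Fixpoint volume (R : realType) (n : nat) : set 'rV[R]_n -> \bar R :=
  match n return set 'rV[R]_n -> \bar R with
  | 0 => fun A => (\1_A (0 : 'rV[R]_0))%:E
  | m.+1 => fun A =>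
      (\int[@lebesgue_measure R]_x
         volume [set y : 'rV[R]_m | A (row_mx (x%:M : 'rV[R]_1) y)])%E
  end.

Definition to_real (R : realType) (n : nat) (z : 'rV[int]_n) : 'rV[R]_n :=
  map_mx intr z.

Definition lattice_point (R : realType) (n : nat) (x : 'rV[R]_n) : Prop :=
  exists z : 'rV[int]_n, x = to_real R z.

Definition lattice_polytope (R : realType) (n : nat)
    (P : set 'rV[R]_n) : Prop :=
  [/\ polytope P, has_dimension P n &
      forall v, vertex P v -> lattice_point v].

Definition subgroup (V : zmodType) (S : set V) : Prop :=
  S 0 /\ forall x y, S x -> S y -> S (x - y).

(* T(A): the sublattice spanned by differences of lattice points of [A]. *)
Definition latticeT (R : realType) (n : nat) (A : set 'rV[R]_n) : set 'rV[int]_n :=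
  smallest (@subgroup 'rV[int]_n)
    [set z | exists x y : 'rV[int]_n,
       [/\ A (to_real R x), A (to_real R y) & z = x - y]].

(* Internal direct sum: every element of [V] is, in exactly one way, a finitely
   supported sum of elements of the [M i], [i] in [I]. *)
Definition direct_sum (J : choiceType) (V : zmodType) (I : set J)
    (M : J -> set V) : Prop :=
  forall z : V, exists! t : J -> V,
    [/\ forall i, I i -> M i (t i),
        forall i, ~ I i -> t i = 0,
        finite_set [set i | t i != 0] &
        z = \sum_(i \in I) t i].

Definition smooth (R : realType) (n : nat) (P : set 'rV[R]_n) : Prop :=
  forall v, vertex P v ->
    direct_sum [set E : set 'rV[R]_n | edge P E /\ E v] (@latticeT R n).

(* A simplex is encoded by its finite set of vertices [sigma]; the simplex as a
   subset of R^n is [conv [set` sigma]]. *)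
Definition faces (R : realType) (n : nat) (k : nat)
    (tau : {fset 'rV[R]_n}) : {fset {fset 'rV[R]_n}} :=
  [fset sigma in fpowerset tau | #|` sigma| == k.+1].

Definition simplices (R : realType) (n : nat) (k : nat)
    (Gamma : {fset {fset 'rV[R]_n}}) : {fset {fset 'rV[R]_n}} :=
  [fset sigma in Gamma | #|` sigma| == k.+1].

Record triangulation (R : realType) (n : nat) (P : set 'rV[R]_n)
    (Gamma : {fset {fset 'rV[R]_n}}) : Prop := Triangulation {
  triangulation_neq0 : forall sigma, sigma \in Gamma -> sigma != fset0;
  triangulation_simplex :
    forall sigma, sigma \in Gamma -> affinely_independent sigma;
  triangulation_face : forall sigma tau, sigma \in Gamma ->
    (tau `<=` sigma)%fset -> tau != fset0 -> tau \in Gamma;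
  (* two simplices meet in a common face, possibly empty *)
  triangulation_meet : forall sigma tau, sigma \in Gamma -> tau \in Gamma ->
    exists rho : {fset 'rV[R]_n}, [/\ (rho `<=` sigma)%fset, (rho `<=` tau)%fset &
      conv [set` sigma] `&` conv [set` tau] = conv [set` rho]];
  triangulation_cover :
    P = \bigcup_(sigma in [set` Gamma]) conv [set` sigma]
}.

Definition unimodular_triangulation (R : realType) (n : nat)
    (P : set 'rV[R]_n) (Gamma : {fset {fset 'rV[R]_n}}) : Prop :=
  [/\ triangulation P Gamma,
      forall sigma v, sigma \in Gamma -> v \in sigma -> lattice_point v &
      forall sigma, sigma \in simplices n Gamma ->
        volume (conv [set` sigma]) = ((n`!)%:R^-1)%:E].

Structure affineSpace (V : zmodType) := AffineSpace {
  affine_pt :> Type;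
  translate : affine_pt -> V -> affine_pt;
  affine_inhabited : inhabited affine_pt;
  translate0 : forall p, translate p 0 = p;
  translateD : forall p u v,
    translate p (u + v) = translate (translate p u) v;
  translate_simply_transitive : forall p q, exists! v, q = translate p v
}.

Definition affine_subspace (V : zmodType) (Q : affineSpace V) (W : set V)
    (E : set Q) : Prop :=
  exists p : Q, E = [set translate p w | w in W].

(* T(A) (x) F_2, realised as the image of T(A) in F_2^n. *)
Definition T2 (R : realType) (n : nat) (A : set 'rV[R]_n) : set 'rV['F_2]_n :=
  [set map_mx (intr : int -> 'F_2) z | z in latticeT A].

Definition T2perp (R : realType) (n : nat) (A : set 'rV[R]_n)
    : set 'Hom('rV['F_2]_n, ('F_2)^o) :=
  [set f | forall u, T2 A u -> f u = 0].

Definition real_phase_structure (R : realType) (n k : nat)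
    (Gamma : {fset {fset 'rV[R]_n}})
    (Q : affineSpace 'Hom('rV['F_2]_n, ('F_2)^o))
    (E : {fset 'rV[R]_n} -> set Q) : Prop :=
  (forall sigma, sigma \in simplices k Gamma ->
     affine_subspace (T2perp (conv [set` sigma])) (E sigma)) /\
  (forall tau, tau \in simplices k.+1 Gamma -> forall s : Q,
     ~~ odd #|` [fset sigma in faces k tau | s \in E sigma]|).

(* Main.v *)
Require Import Defs.
From HB Require Import structures.
From mathcomp Require Import all_boot all_order all_algebra.
From mathcomp Require Import finmap.
From mathcomp Require Import all_classical all_reals all_analysis.
From mathcomp Require Import measurable_realfun zify ring.

Set Implicit Arguments.
Unset Strict Implicit.
Unset Printing Implicit Defensive.

Import Order.TTheory GRing.Theory Num.Theory.
Import numFieldNormedType.Exports.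

Local Open Scope fset_scope.
Local Open Scope classical_set_scope.
Local Open Scope ring_scope.

(** Fix a total order on the vertices of the triangulation.  For a [k]-simplex
    [s] with vertices [w_0 < ... < w_k], let [E s] consist of the points
    [q0 + f] of the affine space such that [f (w_i) - f (w_j) = i - j] modulo 2:
    the functional alternates along the ordered vertices of [s].

    Around a [k+1]-simplex with vertices [v_0 < ... < v_m], the parity condition
    is a telescoping sum.  Correct [f] by the rank, [g (v_j) = f (v_j) - j].
    Deleting [v_i] shifts the ranks above [i] by one, so [f] alternates on the
    facet opposite to [v_i] exactly when [g (v_j) + [i <= j]] is constant in [j]
    or [g (v_j) + [i < j]] is, i.e. when one of the conditions [Q i], [Q (i+1)]
    holds, where [Q i] says that [g] jumps exactly at position [i].  The two are
    exclusive ([alternates_threshold]), so the number of facets modulo 2 is the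
    sum of the [Q i + Q (i+1)], that is [Q 0 + Q (m+1)]; both end terms say that
    [g] is constant, and the total is even ([even_alternates]).

    That [E s] is an affine subspace directed by the annihilator of the lattice
    of [s] is where unimodularity enters.  A simplex of the triangulation is a
    face of a full-dimensional one ([triangulation_pure]): a generic ray issued
    from the barycentre [p] of [s] towards a point of the polytope starts inside
    a full-dimensional simplex [t], hence [p] lies in [t], and since simplices
    meet in faces [s] is a face of [t].  The volume of [t] is [|det N| / n!] for
    the matrix [N] of its vertices in homogeneous coordinates
    ([volume_simplex]), so [det N] is [1] or [-1].  Therefore barycentric
    coordinates of lattice points are integers, which identifies the annihilator
    ([T2perp_convE]), and [N] is still invertible modulo 2, so that functionals
    with prescribed values on the vertices exist
    ([unimodular_simplex_functional]).

    For the volume formula, note that the slices of a set defined by finitely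
    many affine inequalities are sets of the same kind.  This gives
    measurability, and the action of an invertible linear map on such volumes
    ([volume_scaling_unitmx]) by induction on the dimension: maps preserving the
    slicing are handled slice by slice, the exchange of the first two
    coordinates by Tonelli, and these generate all invertible maps. *)

(** * Volumes of sets defined by affine inequalities *)

(** The measure [|a| . (x |-> a x + c)_* lebesgue] agrees with the Lebesgue
    measure on intervals, hence everywhere. *)
Lemma ge0_integral_affine_substitution (R : realType) (a c : R)
    (g : R -> \bar R) : a != 0 ->
  measurable_fun [set: R] g ->
  (forall x, (0 <= g x)%E) ->
  (\int[@lebesgue_measure R]_x g x =
   `|a|%:E * \int[@lebesgue_measure R]_x g (a * x + c)%R)%E.
Proof.
move=> a0 mg g0.
pose phi : measurableTypeR R -> measurableTypeR R := fun x => a * x + c.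
have mphi : measurable_fun setT phi.
  by apply: measurable_funD => //; exact: measurable_funM.
have [nu nuE] : {nu : {measure set (measurableTypeR R) -> \bar R} |
    nu = mscale (NngNum (normr_ge0 a)) (pushforward (@lebesgue_measure R) phi)
      :> (set (measurableTypeR R) -> \bar R)}.
  by eexists.
have E : forall A : set (measurableTypeR R), measurable A ->
    lebesgue_measure A = nu A.
  apply: lebesgue_measure_unique => _ [[p q]] _ <-.
  rewrite nuE/= /mscale/= /pushforward /=.
  have [a_gt0|a_lt0|/eqP] := ltgtP 0 a; last by rewrite eq_sym (negbTE a0).
    have -> : phi @^-1` `]p, q] = `](p - c) / a, (q - c) / a]%classic.
      apply/seteqP; split => x /=; rewrite /phi !in_itv/= ltr_pdivrMr// ler_pdivlMr//;
      by rewrite ltrBlDr lerBrDr [x * a]mulrC.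
    rewrite !lebesgue_measure_itv/= !lte_fin ltr_pM2r ?invr_gt0// ltrD2r.
    case: ifP => _; last by rewrite mule0.
    rewrite gtr0_norm// -!EFinB -EFinM; congr EFin; field; exact: a0.
  have -> : phi @^-1` `]p, q] = `[(q - c) / a, (p - c) / a[%classic.
    apply/seteqP; split => x /=; rewrite /phi !in_itv/= ltr_ndivlMr// ler_ndivrMr//;
    by rewrite ltrBlDr lerBrDr [x * a]mulrC andbC.
  rewrite !lebesgue_measure_itv/= !lte_fin ltr_nM2r ?invr_lt0// ltrD2r.
  case: ifP => _; last by rewrite mule0.
  rewrite ltr0_norm// -!EFinB -EFinM; congr EFin; field; exact: a0.
rewrite (@eq_measure_integral _ _ _ _ nu) => [|A mA _]; last exact: E.
rewrite nuE.
rewrite ge0_integral_mscale//=.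
congr (_ * _)%E.
by rewrite (ge0_integral_pushforward mphi) ?preimage_setT//.
Qed.

Definition polyhedron (R : realType) (n m : nat) (A : 'M[R]_(n, m))
    (b : 'rV[R]_m) : set 'rV[R]_n :=
  [set y | forall j, 0 <= (y *m A + b) 0 j].

Lemma volume_ge0 (R : realType) (n : nat) (A : set 'rV[R]_n) :
  (0 <= volume A)%E.
Proof.
elim: n A => [|n IH] A /=; first by rewrite lee_fin.
by apply: integral_ge0 => x _; exact: IH.
Qed.

(** A slice of a polyhedron has the same linear part, with the first row
    removed; only the constant terms depend on the position of the slice.  This
    is why [b] varies in all the statements below. *)
Lemma volume_polyhedronS (R : realType) (n m : nat) (A : 'M[R]_(1 + n, m))
    (b : 'rV[R]_m) :
  (volume (polyhedron A b) = \int[@lebesgue_measure R]_x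
     volume (polyhedron (dsubmx A) (b + x *: usubmx A)))%E.
Proof.
apply: eq_integral => x _; congr volume; apply: eq_set => y.
rewrite /polyhedron /=.
have -> : row_mx x%:M y *m A = x *: usubmx A + y *m dsubmx A.
  by rewrite -{1}[A]vsubmxK mul_row_col mul_scalar_mx.
by rewrite [x *: _ + _]addrC -addrA [_ *: _ + b]addrC.
Qed.

(** Measurability is needed jointly in all the coordinates that have been
    fixed so far, hence an arbitrary parameter space [T]: the induction adds one
    real coordinate to it. *)
Lemma measurable_volume_polyhedron (R : realType) (n m : nat)
    (A : 'M[R]_(n, m)) d (T : measurableType d) (b : T -> 'rV[R]_m) :
  (forall j, measurable_fun setT (fun t => b t 0 j)) ->
  measurable_fun setT (fun t => volume (polyhedron A (b t))).
Proof.
elim: n A d T b => [|n IH] A d T b mb.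
  apply/measurable_EFinP.
  rewrite (_ : (fun t => _) =
      \1_(\bigcap_(j in [set: 'I_m]) [set t | 0 <= b t 0 j])).
    apply: measurable_indic; apply: fin_bigcap_measurable => // j _.
    rewrite -[X in measurable X]setTI.
    exact: measurable_fun_le measurableT (measurable_cst (0:R)) (mb j).
  apply/funext => t; rewrite !indicE; congr (_%:R); congr nat_of_bool.
  apply/idP/idP; rewrite !inE => h j; last first.
    by rewrite mul0mx add0r; exact: h.
  by move=> _; have := h j; rewrite mul0mx add0r.
pose F (p : T * measurableTypeR R) :=
  volume (polyhedron (dsubmx (A : 'M[R]_(1 + n, m)))
     (b p.1 + p.2 *: usubmx (A : 'M[R]_(1 + n, m)))).
have mF : measurable_fun setT F.
  apply: IH => j; under eq_fun do rewrite !mxE.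
  apply: measurable_funD; first exact: measurableT_comp (mb j) _.
  by apply: measurable_funM.
have := @measurable_fun_fubini_tonelli_F _ _ _ _ _ (@lebesgue_measure R) F mF
  (fun _ => volume_ge0 _).
congr measurable_fun; apply/funext => t.
by rewrite (volume_polyhedronS (A : 'M[R]_(1 + n, m))).
Qed.

Lemma measurable_volume_slices (R : realType) (n m : nat)
    (A : 'M[R]_(n, m)) (b r : 'rV[R]_m) :
  measurable_fun [set: R] (fun x => volume (polyhedron A (b + x *: r))).
Proof.
apply: measurable_volume_polyhedron => j; under eq_fun do rewrite !mxE.
by apply: measurable_funD => //; exact: measurable_funM.
Qed.

Lemma mul_row_first (R : pzRingType) (n m : nat) (c : 'rV[R]_(1 + n))
    (A : 'M[R]_(1 + n, m)) :
  c *m A = lsubmx c 0 0 *: usubmx A + rsubmx c *m dsubmx A.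
Proof.
rewrite -[in LHS](hsubmxK c) -[in LHS](vsubmxK A) mul_row_col.
by rewrite {1}[lsubmx c]mx11_scalar mul_scalar_mx.
Qed.

Lemma volume_polyhedron_translate (R : realType) (n m : nat)
    (A : 'M[R]_(n, m)) (b : 'rV[R]_m) (c : 'rV[R]_n) :
  volume (polyhedron A (b + c *m A)) = volume (polyhedron A b).
Proof.
elim: n A b c => [|n IH] A b c; first by rewrite (flatmx0 A) mulmx0 addr0.
rewrite !(volume_polyhedronS (A : 'M[R]_(1 + n, m))).
rewrite [RHS](@ge0_integral_affine_substitution _ 1
  (lsubmx (c : 'M[R]_(1, 1 + n)) 0 0)) ?oner_eq0//; first last.
- by move=> x; exact: volume_ge0.
- exact: measurable_volume_slices.
rewrite normr1 mul1e; apply: eq_integral => x _.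
rewrite -[RHS](IH _ _ (rsubmx (c : 'M[R]_(1, 1 + n)))); congr (volume (polyhedron _ _)).
rewrite (mul_row_first (c : 'M[R]_(1, 1 + n))) mul1r scalerDl -!addrA.
by congr (_ + _); rewrite addrA addrC.
Qed.

(** [polyhedron (B *m A) b] is the preimage of [polyhedron A b] under
    [y |-> y B]; preimages, unlike images, are given by inequalities without
    inverting [B]. *)
Definition volume_scaling (R : realType) (n : nat) (B : 'M[R]_n) : Prop :=
  forall m (A : 'M[R]_(n, m)) (b : 'rV[R]_m),
    (`|\det B|%:E * volume (polyhedron (B *m A) b) =
     volume (polyhedron A b))%E.

Lemma volume_scalingM (R : realType) (n : nat) (B C : 'M[R]_n) :
  volume_scaling B -> volume_scaling C -> volume_scaling (B *m C).
Proof.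
move=> hB hC m A b; rewrite det_mulmx normrM EFinM -mulmxA.
by rewrite [X in (X * _)%E]muleC -muleA hB hC.
Qed.

Lemma volume_scalingV (R : realType) (n : nat) (B : 'M[R]_n) :
  B \in unitmx -> volume_scaling B -> volume_scaling (invmx B).
Proof.
move=> uB hB m A b; rewrite -(hB _ (invmx B *m A)) mulKVmx// muleA -EFinM.
by rewrite -normrM -det_mulmx mulVmx// det1 normr1 mul1e.
Qed.

(** The map [y |-> y B] sends slices to slices here: it scales the first
    coordinate by [a] and acts on each slice by [D] and a translation. *)
Lemma volume_scaling_block (R : realType) (n : nat) (a : R) (r : 'rV[R]_n)
    (D : 'M[R]_n) : a != 0 -> volume_scaling D ->
  volume_scaling (block_mx a%:M r 0 D : 'M[R]_(1 + n)).
Proof.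
move=> a0 hD m A b; rewrite det_ublock det_scalar1 normrM.
rewrite !volume_polyhedronS -{1 2}[A]vsubmxK mul_block_col.
rewrite col_mxKu col_mxKd mul0mx add0r mul_scalar_mx.
rewrite [RHS](@ge0_integral_affine_substitution _ a 0) //; first last.
- by move=> x; exact: volume_ge0.
- exact: measurable_volume_slices.
rewrite EFinM -muleA; congr (_ * _)%E.
rewrite -ge0_integralZl//; first last.
- by move=> x _; exact: volume_ge0.
- exact: measurable_volume_slices.
apply: eq_integral => x _; rewrite hD addr0.
rewrite -[RHS](volume_polyhedron_translate _ _ (x *: r)).
by rewrite scalerDr scalerA -scalemxAl [x * a]mulrC addrA.
Qed.

Lemma volume_polyhedron_swap (R : realType) (n m : nat) (r s : 'rV[R]_m)
    (A : 'M[R]_(n, m)) (b : 'rV[R]_m) :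
  volume (polyhedron (col_mx r (col_mx s A) : 'M[R]_(1 + (1 + n), m)) b) =
  volume (polyhedron (col_mx s (col_mx r A) : 'M[R]_(1 + (1 + n), m)) b).
Proof.
rewrite !volume_polyhedronS !col_mxKu !col_mxKd.
under eq_integral do rewrite volume_polyhedronS col_mxKu col_mxKd.
under [RHS]eq_integral do rewrite volume_polyhedronS col_mxKu col_mxKd.
rewrite (@fubini_tonelli _ _ _ _ _ lebesgue_measure lebesgue_measure
  (fun p => volume (polyhedron A (b + p.1 *: r + p.2 *: s))))/=.
- by apply: eq_integral => y _; apply: eq_integral => x _; rewrite addrAC.
- apply: measurable_volume_polyhedron => j; under eq_fun do rewrite !mxE.
  by apply: measurable_funD; first apply: measurable_funD => //;
    apply: measurable_funM.
- by move=> p; exact: volume_ge0.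
Qed.

Definition swap_mx (R : realType) (n : nat) : 'M[R]_(1 + (1 + n)) :=
  col_mx (row_mx 0 (row_mx 1%:M 0))
    (col_mx (row_mx 1%:M 0) (row_mx 0 (row_mx 0 1%:M))).

Lemma mul_swap_mx (R : realType) (n m : nat) (r s : 'rV[R]_m)
    (A : 'M[R]_(n, m)) :
  swap_mx R n *m (col_mx r (col_mx s A)) = col_mx s (col_mx r A).
Proof.
by rewrite /swap_mx !mul_col_mx !mul_row_col !(mul0mx, mul1mx, add0r, addr0).
Qed.

Lemma swap_mxK (R : realType) (n : nat) : swap_mx R n *m swap_mx R n = 1%:M.
Proof.
rewrite {2}/swap_mx mul_swap_mx !scalar_mx_block /block_mx.
by congr col_mx; rewrite -[X in _ = row_mx X _]col_mx0 -[RHS]block_mxEh.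
Qed.

Lemma volume_scaling_swap (R : realType) (n : nat) :
  volume_scaling (swap_mx R n).
Proof.
move=> m A b.
have -> : `|\det (swap_mx R n)| = 1.
  have : `|\det (swap_mx R n)| ^+ 2 == 1.
    by rewrite expr2 -normrM -det_mulmx swap_mxK det1 normr1.
  by rewrite -[1 in X in X -> _](expr1n _ 2) eqrXn2 // => /eqP.
rewrite mul1e -[A]vsubmxK -[dsubmx A]vsubmxK mul_swap_mx.
exact: volume_polyhedron_swap.
Qed.

(** A nonzero column has rank one; [U] comes from its Gaussian elimination. *)
Lemma exists_unit_mul_col (F : fieldType) (n : nat) (c : 'cV[F]_(1 + n)) :
  c != 0 -> exists U : 'M[F]_(1 + n), exists l : F,
    [/\ U \in unitmx, l != 0 & U *m c = col_mx l%:M 0].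
Proof.
move=> c0; exists (invmx (col_ebase c)), (row_ebase c 0 0); set l := row_ebase c 0 0.
have rE : row_ebase c = l%:M by exact: mx11_scalar.
have rk : \rank c = 1%N.
  by apply/eqP; rewrite eqn_leq rank_leq_col lt0n mxrank_eq0.
split; first by rewrite unitmx_inv col_ebase_unit.
  by have := row_ebase_unit c; rewrite rE unitmxE det_scalar1 unitfE.
rewrite -{2}(mulmx_ebase c) -mulmxA mulKmx ?col_ebase_unit// rk.
rewrite rE mul_mx_scalar.
rewrite (_ : pid_mx 1 = col_mx 1%:M 0).
  by rewrite scale_col_mx scaler0 scale_scalar_mx mulr1.
by rewrite pid_mx_col.
Qed.

(** If the first column of [B] vanishes below the diagonal, [B] respects the
    slicing.  Otherwise row operations that respect the slicing bring the
    first column to [(0, l, 0, ..., 0)], and exchanging the first two rows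
    leads back to the previous case. *)
Theorem volume_scaling_unitmx (R : realType) (n : nat) (B : 'M[R]_n) :
  B \in unitmx -> volume_scaling B.
Proof.
elim: n B => [|n IH] B.
  move=> _ m A b; rewrite det_mx00 normr1 mul1e.
  by rewrite (flatmx0 (B *m A)) (flatmx0 A).
rewrite -[n.+1]/(1 + n)%N in B *.
have IHblock (C : 'M[R]_(1 + n)) :
    C \in unitmx -> dlsubmx C = 0 -> volume_scaling C.
  rewrite -{1 3}[C]submxK => + dl; rewrite dl unitmxE det_ublock unitrM.
  rewrite [ulsubmx C]mx11_scalar det_scalar1 unitfE => /andP[a0 uD].
  by apply: volume_scaling_block => //; apply: IH; rewrite unitmxE.
move=> uB; have [|c0] := eqVneq (dlsubmx B) 0; first exact: IHblock.
case: n B IH IHblock uB c0 => [|n] B IH IHblock uB c0.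
  by rewrite (flatmx0 (dlsubmx B)) eqxx in c0.
have [U [l [uU l0 Ul]]] := exists_unit_mul_col c0.
(* [U] makes the column below the diagonal equal to [(l, 0, ..., 0)]. *)
pose B1 := (block_mx 1%:M 0 0 U : 'M[R]_(1 + (1 + n))) *m B.
have B1E : B1 = block_mx (ulsubmx B) (ursubmx B) (U *m dlsubmx B) (U *m drsubmx B).
  by rewrite /B1 -{1}[B]submxK mulmx_block !mul1mx !mul0mx !addr0 !add0r.
(* Subtracting a multiple of the second row clears the diagonal entry. *)
pose a := ulsubmx B 0 0.
pose P2 : 'M[R]_(1 + (1 + n)) :=
  block_mx 1%:M (row_mx (- a / l)%:M 0) 0 1%:M.
pose B2 := P2 *m B1.
have ulB2 : ulsubmx B2 = 0.
  rewrite /B2 /P2 B1E mulmx_block block_mxKul Ul mul_row_col mul0mx addr0 mul1mx.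
  rewrite -scalar_mxM divfK// [ulsubmx B]mx11_scalar -/a -raddfD/=.
  by rewrite subrr raddf0.
have dlB2 : dlsubmx B2 = col_mx l%:M 0.
  by rewrite /B2 /P2 B1E mulmx_block block_mxKdl mul0mx add0r mul1mx.
have uP1 : (block_mx 1%:M 0 0 U : 'M[R]_(1 + (1 + n))) \in unitmx.
  by rewrite unitmxE det_ublock det1 mul1r.
have uP2 : P2 \in unitmx by rewrite unitmxE det_ublock !det1 mul1r unitr1.
have uS : swap_mx R n \in unitmx.
  by have /mulmx1_unit[] := swap_mxK R n.
have -> : B = invmx (block_mx 1%:M 0 0 U) *m
    (invmx P2 *m (swap_mx R n *m (swap_mx R n *m B2))).
  by rewrite [swap_mx R n *m _]mulmxA swap_mxK mul1mx /B2 !mulKmx.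
apply: volume_scalingM.
  by apply: volume_scalingV => //; apply: IHblock => //; rewrite block_mxKdl.
apply: volume_scalingM.
  by apply: volume_scalingV => //; apply: IHblock => //; rewrite block_mxKdl.
apply: volume_scalingM; first exact: volume_scaling_swap.
apply: IHblock; first by rewrite !unitmx_mul uS uP2 uP1 uB.
rewrite -[B2]vsubmxK -[dsubmx B2]vsubmxK mul_swap_mx /dlsubmx col_mxKd.

have -> : dsubmx (dsubmx B2) = row_mx 0 (rsubmx (dsubmx (dsubmx B2))).
  rewrite -{1}[dsubmx (dsubmx B2)]hsubmxK; congr row_mx.
  have -> : lsubmx (dsubmx (dsubmx B2)) = dsubmx (dlsubmx B2).
    by apply/matrixP => i j; rewrite !mxE.
  by rewrite dlB2 col_mxKd.
have -> : usubmx B2 = row_mx 0 (rsubmx (usubmx B2)).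
  by rewrite -{1}[usubmx B2]hsubmxK; congr row_mx.
by rewrite -[col_mx _ _]block_mxEv block_mxEh row_mxKl col_mx0.
Qed.

Lemma volume0 (R : realType) (n : nat) : volume (set0 : set 'rV[R]_n) = 0%E.
Proof.
elim: n => [|n IH] /=; first by rewrite indic0.
under eq_integral do rewrite -[X in volume X]/set0 IH.
exact: integral0.
Qed.

Lemma integral_deriv_poly (R : realType) (p : {poly R}) (a b : R) : a <= b ->
  (\int[@lebesgue_measure R]_(x in `[a, b]) (p^`().[x])%:E =
   (p.[b] - p.[a])%:E)%E.
Proof.
rewrite le_eqVlt => /predU1P[<-|ab].
  by rewrite set_itv1 integral_set1 subrr.
rewrite EFinB; apply: continuous_FTC2 => //.
- by apply: continuous_subspaceT => x; exact: continuous_horner.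
- split.
  + by move=> x _; exact: derivable_horner.
  + by apply: cvg_at_right_filter; exact: continuous_horner.
  + by apply: cvg_at_left_filter; exact: continuous_horner.
- by move=> x _; rewrite -derivE.
Qed.

Lemma integral_exprn_sub (R : realType) (n : nat) (t : R) : 0 <= t ->
  (\int[@lebesgue_measure R]_(x in `[0%R, t]) ((t - x) ^+ n / n`!%:R)%:E =
   (t ^+ n.+1 / n.+1`!%:R)%:E)%E.
Proof.
move=> t0; pose p : {poly R} := - ((n.+1)`!%:R^-1 *: (t%:P - 'X) ^+ n.+1).
have dp x : (t - x) ^+ n / n`!%:R = p^`().[x].
  rewrite /p derivN derivZ deriv_exp derivB derivC derivX sub0r /=.
  rewrite !hornerE hornerMn !hornerE/= factS natrM.
  by field; rewrite pnatr_eq0 -lt0n fact_gt0 nat1r pnatr_eq0.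
under eq_integral do rewrite dp.
rewrite integral_deriv_poly// /p !hornerE/= subrr expr0n/=.
by rewrite mulr0 oppr0 sub0r opprK addr0 mulrC.
Qed.

Definition corner_simplex (R : realType) (n : nat) (t : R) : set 'rV[R]_n :=
  [set y | (forall i, 0 <= y 0 i) /\ \sum_i y 0 i <= t].
Arguments corner_simplex {R} n t.

Lemma volume_corner_simplex (R : realType) (n : nat) (t : R) : 0 <= t ->
  volume (corner_simplex n t) = (t ^+ n / n`!%:R)%:E.
Proof.
elim: n t => [|n IH] t t0.
  rewrite /= expr0 fact0 divr1; congr EFin; rewrite indicE mem_set//.
  by split=> [[]//|]; rewrite big_ord0.
rewrite -integral_exprn_sub// [RHS]integral_mkcond; apply: eq_integral => x _.
rewrite patchE.
have slice (y : 'rV[R]_n) :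
    corner_simplex (1 + n) t (row_mx (x%:M : 'rV[R]_1) y) <->
    0 <= x /\ corner_simplex n (t - x) y.
  rewrite /corner_simplex /= big_split_ord/= big_ord1 row_mxEl mxE mulr1n.
  under eq_bigr do rewrite row_mxEr.
  rewrite lerBrDl; split=> [[y0 ?]|[x0 [y0 ?]]].
    split; first by have := y0 (lshift n 0); rewrite row_mxEl mxE mulr1n.
    by split=> // i; have := y0 (rshift 1 i); rewrite row_mxEr.
  split=> // i; case: (split_ordP i) => j ->; last by rewrite row_mxEr.
  by rewrite row_mxEl ord1 mxE mulr1n.
case: ifPn => [|xnot].
  rewrite inE/= in_itv/= => /andP[x0 xt]; rewrite -IH ?subr_ge0//.
  by congr volume; apply/seteqP; split=> y /= => [/slice[]//|?]; exact/slice.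
rewrite -[RHS](@volume0 R n); congr volume; apply/seteqP; split=> y //= /slice.
move=> [x0 [y0 yt]]; move/negP : xnot; apply; rewrite inE/= in_itv/= x0/=.
by rewrite -subr_ge0 (le_trans _ yt)// sumr_ge0.
Qed.

Lemma corner_simplexE (R : realType) (n : nat) (t : R) :
  corner_simplex n t =
  polyhedron (row_mx (const_mx (- 1)) 1%:M : 'M[R]_(n, 1 + n))
    (row_mx (t%:M : 'rV[R]_1) 0).
Proof.
have E (y : 'rV[R]_n) : y *m row_mx (const_mx (- 1) : 'cV[R]_n) 1%:M +
    row_mx (t%:M : 'rV[R]_1) 0 = row_mx (t - \sum_i y 0 i)%:M y.
  rewrite mul_mx_row mulmx1 add_row_mx addr0; congr row_mx.
  apply/matrixP => i j; rewrite !ord1 !mxE !mulr1n addrC; congr (_ + _).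
  by rewrite -sumrN; apply: eq_bigr => k _; rewrite mxE mulrN1.
apply/seteqP; split=> y /=; rewrite /polyhedron /=.
  move=> [y0 yt] j; rewrite E; case: (split_ordP j) => k ->.
    by rewrite row_mxEl ord1 mxE mulr1n subr_ge0.
  by rewrite row_mxEr.
rewrite E => h; split=> [i|].
  by have := h (rshift 1 i); rewrite row_mxEr.
by have := h (lshift n 0); rewrite row_mxEl mxE mulr1n subr_ge0.
Qed.

(** The rows of [N] are the vertices of a simplex in homogeneous coordinates,
    so [y |-> (1, y) N^-1] gives the barycentric coordinates and the polyhedron
    is the simplex.  Subtracting the first vertex from the others reduces it to
    the image of the corner simplex under an affine map. *)
Theorem volume_simplex (R : realType) (n : nat) (N : 'M[R]_(1 + n)) :
  N \in unitmx -> lsubmx N = const_mx 1 ->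
  volume (polyhedron (dsubmx (invmx N)) (usubmx (invmx N))) =
  (`|\det N| / n`!%:R)%:E.
Proof.
move=> uN N1.
pose L : 'M[R]_(1 + n) := block_mx 1%:M 0 (const_mx 1) 1%:M.
pose L' : 'M[R]_(1 + n) := block_mx 1%:M 0 (const_mx (- 1)) 1%:M.
have LL' : L *m L' = 1%:M.
  rewrite mulmx_block !(mul1mx, mulmx1, mul0mx, mulmx0, add0r, addr0).
  rewrite [RHS]scalar_mx_block; congr block_mx.
  by apply/matrixP => i j; rewrite !mxE subrr.
pose v := ursubmx N; pose M := drsubmx N - const_mx 1 *m v.
have N1E i : N i (lshift n 0) = 1.
  by have := congr1 (fun A : 'cV_(1 + n) => A i 0) N1; rewrite !mxE.
have NE : N = L *m block_mx 1%:M v 0 M.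
  rewrite mulmx_block !(mul1mx, mulmx1, mul0mx, mulmx0, add0r, addr0).
  rewrite /M addrC subrK -[LHS]submxK; congr block_mx.
    by apply/matrixP => i j; rewrite !ord1 !mxE N1E.
  by apply/matrixP => i j; rewrite ord1 !mxE N1E.
have L1 : \det L = 1 by rewrite det_lblock !det1 mulr1.
have dN : \det N = \det M by rewrite NE det_mulmx L1 det_ublock det1 !mul1r.
have uM : M \in unitmx by rewrite unitmxE -dN -unitmxE.
pose G := block_mx 1%:M v 0 M.
pose G' := block_mx 1%:M (- v *m invmx M) 0 (invmx M).
have GG' : G *m G' = 1%:M.
  rewrite mulmx_block !(mul1mx, mulmx1, mul0mx, mulmx0, add0r, addr0).
  by rewrite mulNmx addNr mulmxV// -scalar_mx_block.
have -> : invmx N = G' *m L'.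
  by apply: (can_inj (mulKmx uN)); rewrite mulmxV// NE -mulmxA (mulmxA G) GG' mul1mx LL'.
pose A : 'M[R]_(n, 1 + n) := row_mx (const_mx (- 1)) 1%:M.
pose b : 'rV[R]_(1 + n) := row_mx 1%:M 0.
have -> : G' *m L' = col_mx (b + - v *m (invmx M *m A)) (invmx M *m A).
  rewrite -[L']/(col_mx b A) mul_block_col mul1mx mul0mx add0r mulmxA.
  by [].
rewrite col_mxKu col_mxKd volume_polyhedron_translate.
have uV : invmx M \in unitmx by rewrite unitmx_inv.
have := volume_scaling_unitmx uV A b.
rewrite -corner_simplexE volume_corner_simplex// expr1n det_inv normfV dN => h.
have d0 : `|\det M| != 0 by rewrite normr_eq0 -unitfE -unitmxE.
by rewrite -[LHS]mul1e -{1}(divff d0) EFinM -muleA h -EFinM div1r.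
Qed.

(** * Simplices in homogeneous coordinates *)

Lemma convex_setP (R : realType) (n : nat) (A : set 'rV[R]_n) :
  convex_set (A : set (convex_lmodType 'rV[R]_n)) <->
  forall x y t, 0 <= t -> t <= 1 -> A x -> A y ->
    A (t *: x + (1 - t) *: y).
Proof.
split=> [cA x y t t0 t1 Ax Ay|cA x y l].
  have t01 : Itv.spec (@Itv.num_sem R) (Itv.Real `[0%Z, 1%Z]) t.
    by apply/and3P; split; rewrite /= ?num_real// t0 t1.
  have := cA x y (Itv.mk t01); rewrite !inE; exact.
by rewrite !inE => Ax Ay; apply: cA.
Qed.

Lemma convex_set_combination (R : realType) (n : nat) (A : set 'rV[R]_n)
    (s : seq 'rV[R]_n) (c : 'rV[R]_n -> R) :
  convex_set (A : set (convex_lmodType 'rV[R]_n)) ->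
  (forall v, v \in s -> A v) -> (forall v, v \in s -> 0 <= c v) ->
  \sum_(v <- s) c v = 1 -> A (\sum_(v <- s) c v *: v).
Proof.
move=> /convex_setP cA; elim: s c => [|v s IH] c sA c0.
  by rewrite big_nil => /eqP; rewrite eq_sym oner_eq0.
have vA : A v by apply: sA; rewrite mem_head.
have {}IH := IH _ (fun w ws => sA w (mem_behead (s := v :: s) ws)).
have {}c0s w : w \in s -> 0 <= c w.
  by move=> ws; apply: c0; rewrite inE ws orbT.
rewrite !big_cons; set S := \sum_(j <- s) c j => cS.
have S0 : 0 <= S by rewrite /S big_seq sumr_ge0.
have [S_eq0|S_neq0] := eqVneq S 0.
  rewrite S_eq0 addr0 in cS; rewrite cS scale1r big1_seq ?addr0// => w /= ws.
  move/eqP: S_eq0; rewrite /S big_seq psumr_eq0// => /allP/(_ _ ws).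
  by rewrite ws/= => /eqP ->; rewrite scale0r.
have -> : \sum_(j <- s) c j *: j = (1 - c v) *: \sum_(j <- s) (S^-1 * c j) *: j.
  rewrite -cS addrAC subrr add0r scaler_sumr; apply: eq_bigr => w _.
  by rewrite scalerA mulVKf.
apply: cA => //.
- by apply: c0; rewrite mem_head.
- by rewrite -cS lerDl.
- apply: IH => [w ws|]; first by rewrite mulr_ge0 ?invr_ge0 ?c0s.
  by rewrite -mulr_sumr mulVf.
Qed.

Lemma conv_fsetP (R : realType) (n : nat) (s : {fset 'rV[R]_n}) y :
  Defs.conv [set` s] y <->
  exists c : 'rV[R]_n -> R, [/\ forall v, v \in s -> 0 <= c v,
    \sum_(v <- s) c v = 1 & y = \sum_(v <- s) c v *: v].
Proof.
split=> [|[c [c0 c1 ->]] A [cA sA]]; last first.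
  by apply: convex_set_combination.
set K := [set z | exists c : 'rV[R]_n -> R, [/\ forall v, v \in s -> 0 <= c v,
    \sum_(v <- s) c v = 1 & z = \sum_(v <- s) c v *: v]].
move=> /(_ K); apply; split.
  apply/convex_setP => x z t t0 t1 [c [c0 c1 ->]] [d [d0 d1 ->]].
  exists (fun v => t * c v + (1 - t) * d v); split=> [v vs||].
  - by rewrite addr_ge0// mulr_ge0 ?subr_ge0 ?c0 ?d0.
  - by rewrite big_split/= -!mulr_sumr c1 d1 !mulr1 addrC subrK.
  - rewrite !scaler_sumr -big_split/=; apply: eq_bigr => v _.
    by rewrite !scalerA -scalerDl.
move=> v /= vs; exists (fun w => (w == v)%:R); split=> [w _||].
- exact: ler0n.
- rewrite (big_fsetD1 v)//= eqxx big_seq big1 ?addr0// => w.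
  by rewrite in_fsetD1 => /andP[/negPf->].
- rewrite (big_fsetD1 v)//= eqxx scale1r big_seq big1 ?addr0// => w.
  by rewrite in_fsetD1 => /andP[/negPf->]; rewrite scale0r.
Qed.

(** Affine independence, barycentric coordinates and reduction modulo 2 all
    become statements of linear algebra about this matrix of homogeneous
    coordinates, over the reals, the integers and [F_2] respectively. *)
Definition vertex_mx (R : nzRingType) (n k : nat) (t : nat -> 'rV[R]_n) :
    'M[R]_(k, 1 + n) :=
  \matrix_(i < k) row_mx 1%:M (t i).

Lemma mul_vertex_mx (R : nzRingType) (n k : nat) (t : nat -> 'rV[R]_n)
    (u : 'rV[R]_k) :
  u *m vertex_mx k t =
  row_mx (\sum_(i < k) u 0 i)%:M (\sum_(i < k) u 0 i *: t i).
Proof.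
rewrite mulmx_sum_row [RHS](_ : _ =
    \sum_(i < k) row_mx (u 0 i)%:M (u 0 i *: t i)).
  apply: eq_bigr => i _.
  by rewrite rowK scale_row_mx scale_scalar_mx mulr1.
apply/rowP => j; rewrite summxE; case: (split_ordP j) => l ->.
  rewrite row_mxEl; under [RHS]eq_bigr do rewrite row_mxEl.
  by rewrite !mxE -sumrMnl; apply: eq_bigr => i _; rewrite mxE.
rewrite row_mxEr summxE; by under [RHS]eq_bigr do rewrite row_mxEr.
Qed.

Lemma lsubmx_vertex_mx (R : nzRingType) (n k : nat) (t : nat -> 'rV[R]_n) :
  lsubmx (vertex_mx k t) = const_mx 1.
Proof.
by apply/matrixP => i j; rewrite mxE mxE row_mxEl ord1 !mxE.
Qed.

Lemma sum_fset_nth (R : realType) (n k : nat) (V : zmodType)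
    (s : {fset 'rV[R]_n}) (F : 'rV[R]_n -> V) : #|` s| = k ->
  \sum_(v <- s) F v = \sum_(i < k) F (nth 0 s i).
Proof. by move=> sk; rewrite (big_nth 0) sk big_mkord. Qed.

Lemma sum_fset_sub (R : realType) (n : nat) (V : zmodType)
    (s t : {fset 'rV[R]_n}) (F G : 'rV[R]_n -> V) : (s `<=` t)%fset ->
  (forall v, v \notin s -> G v = 0) -> (forall v, v \in s -> G v = F v) ->
  \sum_(v <- t) G v = \sum_(v <- s) F v.
Proof.
move=> st G0 GF; rewrite -(big_fset_incl _ st) => [|v _]; last exact: G0.
by apply: eq_big_seq => v vs; rewrite GF.
Qed.

Lemma combination_vertex_mx (R : realType) (n k : nat)
    (s : {fset 'rV[R]_n}) (c : 'rV[R]_n -> R) :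
  #|` s| = k -> \sum_(v <- s) c v = 1 ->
  row_mx 1%:M (\sum_(v <- s) c v *: v) =
  (\row_(i < k) c (nth 0 s i)) *m vertex_mx k (nth 0 s).
Proof.
move=> sk c1; rewrite mul_vertex_mx -c1 !(sum_fset_nth _ sk).
congr (row_mx _%:M _); apply: eq_bigr => i _; by rewrite mxE.
Qed.

Lemma exists_weights (R : realType) (n k : nat) (s : {fset 'rV[R]_n})
    (u : 'rV[R]_k) : #|` s| = k ->
  exists c : 'rV[R]_n -> R, forall i : 'I_k, c (nth 0 s i) = u 0 i.
Proof.
move=> sk; exists (fun v => oapp (u 0) 0 (insub (index v s) : option 'I_k)).
by move=> i; rewrite index_uniq ?fset_uniq ?sk// valK.
Qed.
Lemma row_free_vertex_mx (R : realType) (n k : nat) (s : {fset 'rV[R]_n}) :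
  #|` s| = k -> affinely_independent s -> row_free (vertex_mx k (nth 0 s)).
Proof.
move=> sk ind; rewrite -kermx_eq0; apply/rowV0P => u /sub_kermxP.
rewrite mul_vertex_mx -[RHS]row_mx0 => /eq_row_mx[u1 u2].
have [c cE] := exists_weights u sk.
apply/rowP => i; rewrite mxE -cE; apply: ind.
- rewrite (sum_fset_nth _ sk); under eq_bigr do rewrite cE.
  by move/matrixP/(_ 0 0): u1; rewrite !mxE mulr1n.
- by rewrite (sum_fset_nth _ sk); under eq_bigr do rewrite cE.
- by rewrite mem_nth// sk.
Qed.

Lemma conv_simplexE (R : realType) (n : nat) (s : {fset 'rV[R]_n})
    (N := vertex_mx (1 + n) (nth 0 s)) :
  #|` s| = n.+1 -> affinely_independent s ->
  Defs.conv [set` s] = polyhedron (dsubmx (invmx N)) (usubmx (invmx N)).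
Proof.
move=> sn ind; have uN : N \in unitmx.
  by rewrite -row_free_unit; exact: row_free_vertex_mx.
have E (y : 'rV[R]_n) : y *m dsubmx (invmx N) + usubmx (invmx N) =
    row_mx 1%:M y *m invmx N.
  by rewrite -{3}[invmx N]vsubmxK mul_row_col mul1mx addrC.
apply/seteqP; split=> y.
  move=> /conv_fsetP[c [c0 c1 ->]] j; rewrite E (combination_vertex_mx sn c1).
  by rewrite mulmxK// mxE c0// mem_nth// sn.
move=> Py; apply/conv_fsetP.
pose u := row_mx 1%:M y *m invmx N.
have u0 j : 0 <= u 0 j by rewrite /u -E; exact: Py.
have : u *m N = row_mx 1%:M y by rewrite mulmxKV.
rewrite mul_vertex_mx => /eq_row_mx[u1 <-].
have [c cE] := exists_weights u (sn : #|` s| = (1 + n)%N).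
exists c; split.
- move=> v vs; have vn : (index v s < 1 + n)%N.
    by rewrite -[X in (_ < X)%N]sn index_mem.
  by rewrite -(nth_index 0 vs) -[index v s]/(val (Ordinal vn)) cE.
- rewrite (sum_fset_nth _ sn); under eq_bigr do rewrite cE.
  by move/matrixP/(_ 0 0): u1; rewrite !mxE !mulr1n.
- by rewrite (sum_fset_nth _ sn); apply: eq_bigr => i _; rewrite cE.
Qed.

(** * Purity of triangulations *)

Definition affine_form (R : realType) (n : nat) (a : 'cV[R]_(1 + n))
    (y : 'rV[R]_n) : R :=
  (row_mx 1%:M y *m a) 0 0.

Lemma affine_form_segment (R : realType) (n : nat) (a : 'cV[R]_(1 + n))
    (x y : 'rV[R]_n) (t : R) :
  affine_form a (t *: x + (1 - t) *: y) =
  affine_form a y + t * (affine_form a x - affine_form a y).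
Proof.
rewrite /affine_form -[a]vsubmxK !mul_row_col !mul1mx mulmxDl -!scalemxAl !mxE.
ring.
Qed.

(** The hypothesis says that the affine function [t |-> a + t b] does not vanish
    identically; it has then at most one zero. *)
Lemma near_affine_neq0 (R : realType) (a b : R) : a != 0 \/ a + b != 0 ->
  \forall t \near 0^'+, a + t * b != 0.
Proof.
move=> ab; have [b0|b0] := eqVneq b 0.
  by near=> t; rewrite b0 mulr0 addr0; move: ab; rewrite b0 addr0 => -[].
have [r0|r0] := ltP 0 (- a / b); near=> t.
  rewrite addrC addr_eq0 eq_sym -(inj_eq (mulIf (invr_neq0 b0))) mulfK//.
  by rewrite gt_eqF//; near: t; exact: nbhs_right_lt.
rewrite addrC addr_eq0 eq_sym -(inj_eq (mulIf (invr_neq0 b0))) mulfK//.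
by rewrite lt_eqF// (le_lt_trans r0)//; near: t; exact: nbhs_right_gt.
Unshelve. all: by end_near. Qed.

Lemma near_affine_lt0 (R : realType) (a b : R) : a < 0 ->
  \forall t \near 0^'+, a + t * b < 0.
Proof.
move=> a0; have [b0|b0] := ltP 0 b; near=> t.
  rewrite addrC -ltrBrDr sub0r -ltr_pdivlMr//; near: t.
  by apply: nbhs_right_lt; rewrite divr_gt0// oppr_gt0.
by rewrite (le_lt_trans _ a0)// gerDl pmulr_rle0.
Unshelve. all: by end_near. Qed.

(** A convex set is not covered by finitely many hyperplanes none of which
    contains it: if [x] avoids some of them and [y] avoids one more, the points
    close to [x] on the segment towards [y] avoid them all. *)
Lemma generic_point (R : realType) (n : nat) (K : set 'rV[R]_n)
    (l : seq 'cV[R]_(1 + n)) :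
  convex_set (K : set (convex_lmodType 'rV[R]_n)) -> K !=set0 ->
  (forall a, a \in l -> exists2 y, K y & affine_form a y != 0) ->
  exists2 x, K x & forall a, a \in l -> affine_form a x != 0.
Proof.
move=> /convex_setP cK [k0 Kk0]; elim: l => [|a l IH] al; first by exists k0.
have [|x Kx xl] := IH; first by move=> b bl; apply: al; rewrite inE bl orbT.
have [|y Ky ya] := al a; first by rewrite mem_head.
have : \forall t \near 0^'+,
    forall b : seq_sub (a :: l), affine_form (ssval b) (t *: y + (1 - t) *: x) != 0.
  apply: filter_forall => -[b /= bal].
  under eq_near do rewrite affine_form_segment.
  apply: near_affine_neq0; rewrite addrC subrK.
  by move: bal; rewrite inE => /predU1P[->|/xl]; [right|left].
move=> near1.
have [t [[t0 t1] ht]] : exists t : R, (0 < t /\ t < 1) /\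
    forall b : seq_sub (a :: l), affine_form (ssval b) (t *: y + (1 - t) *: x) != 0.
  near (0 : R)^'+ => t; exists t; split; last by near: t.
  by split; near: t; [exact: nbhs_right_gt|exact: nbhs_right_lt].
exists (t *: y + (1 - t) *: x); first by apply: cK => //; exact: ltW.
by move=> b bl; exact: ht (SeqSub bl).
Unshelve. all: by end_near. Qed.

Lemma has_dimension_affine_form (R : realType) (n : nat) (K : set 'rV[R]_n)
    (a : 'cV[R]_(1 + n)) :
  has_dimension K n -> a != 0 -> exists2 y, K y & affine_form a y != 0.
Proof.
move=> [[s [sK ind sn]] _] a0; apply: contrapT => noy; move/negP : a0; apply.
have uN : vertex_mx (1 + n) (nth 0 s) \in unitmx.
  by rewrite -row_free_unit; exact: row_free_vertex_mx.
rewrite -[a](mulKmx uN) (_ : vertex_mx _ _ *m a = 0) ?mulmx0//.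
apply/matrixP => i j; rewrite ord1 mxE; apply/eqP; apply: contrapT => /negP h.
apply: noy; exists (nth 0 s i).
  by apply: sK; rewrite /= mem_nth// sn.
rewrite /affine_form mxE; move: h; rewrite mxE.
by under eq_bigr do rewrite mxE.
Qed.

(** The homogeneous coordinates of at most [n] points have rank at most [n] in
    dimension [n + 1]. *)
Lemma exists_affine_form_eq0 (R : realType) (n : nat) (s : {fset 'rV[R]_n}) :
  (#|` s| <= n)%N ->
  exists2 a : 'cV[R]_(1 + n), a != 0 &
    forall y, Defs.conv [set` s] y -> affine_form a y = 0.
Proof.
move=> sn; pose N := vertex_mx #|` s| (nth 0 s).
have : cokermx N != 0.
  by rewrite -mxrank_eq0 mxrank_coker subn_eq0 -ltnNge ltnS (leq_trans (rank_leq_row _)).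
case/matrix0Pn => i [j nz]; exists (col j (cokermx N)).
  by apply: contra nz => /eqP/matrixP/(_ i 0); rewrite !mxE => ->.
move=> y /conv_fsetP[c [_ c1 ->]].
rewrite /affine_form (combination_vertex_mx erefl c1) -/N.
by rewrite colE mulmxA -(mulmxA _ N) mulmx_coker mulmx0 mul0mx mxE.
Qed.

(** A barycentric coordinate that is negative at [p] remains so near [p]. *)
Lemma near_notin_conv (R : realType) (n : nat) (s : {fset 'rV[R]_n}) p x :
  affinely_independent s -> #|` s| = n.+1 -> ~ Defs.conv [set` s] p ->
  \forall t \near 0^'+, ~ Defs.conv [set` s] (t *: x + (1 - t) *: p).
Proof.
move=> ind sn; rewrite conv_simplexE//.
set A := dsubmx _; set b := usubmx _ => /existsNP[j /negP]; rewrite -ltNge => pj.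
near=> t => /(_ j); apply/negP; rewrite -ltNge.
have -> : ((t *: x + (1 - t) *: p) *m A + b) 0 j =
    (p *m A + b) 0 j + t * ((x *m A + b) 0 j - (p *m A + b) 0 j).
  rewrite mulmxDl -!scalemxAl !mxE; ring.
by near: t; exact: near_affine_lt0.
Unshelve. all: by end_near. Qed.

(** The barycentric coordinates of the barycentre are unique and all nonzero. *)
Lemma barycenter_face (R : realType) (n : nat) (s r : {fset 'rV[R]_n}) :
  s != fset0 -> affinely_independent s -> (r `<=` s)%fset ->
  Defs.conv [set` r] (\sum_(v <- s) #|` s|%:R^-1 *: v) -> r = s.
Proof.
move=> s0 ind rs /conv_fsetP[c [_ c1 cE]]; apply/eqP; rewrite eqEfsubset rs/=.
have card0 : #|` s|%:R != 0 :> R by rewrite pnatr_eq0 cardfs_eq0.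
pose d v := #|` s|%:R^-1 - (if v \in r then c v else 0).
apply/fsubsetP => v vs.
have /eqP : d v = 0.
  apply: ind vs; rewrite /d.
    rewrite big_split/= sumrN big_const_seq count_predT iter_addr addr0.
    rewrite (sum_fset_sub (F := c) rs) => [|w /negPf->//|w ->//].
    by rewrite c1 -(mulr_natr _^-1) mulVf ?subrr.
  under eq_bigr do rewrite scalerBl; rewrite big_split/= sumrN.
  rewrite [X in _ - X](sum_fset_sub (F := fun w => c w *: w) rs) => [|w /negPf->|w ->//].
    by rewrite -cE subrr.
  by rewrite /= scale0r.
by rewrite /d; case: ifP => // _; rewrite subr0 invr_eq0 (negbTE card0).
Qed.

Lemma card_affinely_independent (R : realType) (n : nat)
    (s : {fset 'rV[R]_n}) : affinely_independent s -> (#|` s| <= n.+1)%N.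
Proof.
move=> /(row_free_vertex_mx erefl)/eqP <-; exact: rank_leq_col.
Qed.

(** Let [p] be the barycentre of [s].  Were [p] in no full-dimensional simplex,
    choose a hyperplane containing each simplex of lower dimension and consider
    a segment from [p] to a point of [P] outside all these hyperplanes: near [p]
    it would avoid every simplex, although it lies in [P]. *)
Theorem triangulation_pure (R : realType) (n : nat) (P : set 'rV[R]_n)
    (Gamma : {fset {fset 'rV[R]_n}}) (s : {fset 'rV[R]_n}) :
  convex_set (P : set (convex_lmodType 'rV[R]_n)) -> has_dimension P n ->
  triangulation P Gamma -> s \in Gamma ->
  exists2 t, t \in simplices n Gamma & (s `<=` t)%fset.
Proof.
move=> cP dimP tr sG.
have s0 := triangulation_neq0 tr sG; have inds := triangulation_simplex tr sG.
pose p := \sum_(v <- s) #|` s|%:R^-1 *: v.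
have ps : Defs.conv [set` s] p.
  apply/conv_fsetP; exists (fun=> #|` s|%:R^-1); split=> //.
  rewrite big_const_seq count_predT iter_addr addr0 -(mulr_natr _^-1) mulVf//.
  by rewrite pnatr_eq0 cardfs_eq0.
have [[t [tG tn pt]]|nt] := pselect (exists t : {fset 'rV[R]_n},
    [/\ t \in Gamma, #|` t| = n.+1 & Defs.conv [set` t] p]).
  exists t; first by rewrite !inE/= tG tn eqxx.
  have [r [rs rt E]] := triangulation_meet tr sG tG.
  have pr : Defs.conv [set` r] p by rewrite -E; split.
  by rewrite -(barycenter_face s0 inds rs pr).
exfalso.
have Pcov y : P y <-> exists2 t, t \in Gamma & Defs.conv [set` t] y.
  by rewrite {1}(triangulation_cover tr); split=> -[t ? ?]; exists t.
have Pp : P p by apply/Pcov; exists s.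
have /choice[a aP] : forall t : {fset 'rV[R]_n}, exists a : 'cV[R]_(1 + n),
    (#|` t| <= n)%N -> a != 0 /\
    forall y, Defs.conv [set` t] y -> affine_form a y = 0.
  move=> t; have [tn|_] := leqP #|` t| n; last by exists 0.
  by have [a a0 h] := exists_affine_form_eq0 tn; exists a.
have [||x Px xa] := @generic_point R n P
    [seq a t | t <- enum_fset Gamma & (#|` t| <= n)%N] cP.
- by exists p.
- move=> _ /mapP[t + ->]; rewrite mem_filter => /andP[tn _].
  by apply: has_dimension_affine_form => //; have [] := aP t tn.
have : \forall t \near 0^'+, forall r : Gamma,
    ~ Defs.conv [set` val r] (t *: x + (1 - t) *: p).
  apply: filter_forall => -[r /= rG].
  have indr := triangulation_simplex tr rG.
  have [rn|rn] := leqP #|` r| n; last first.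
    have {}rn : #|` r| = n.+1.
      by apply/eqP; rewrite eqn_leq rn card_affinely_independent.
    by apply: near_notin_conv => // pr; apply: nt; exists r.
  have [_ ar] := aP r rn.
  have arx : affine_form (a r) x != 0.
    by apply: xa; apply/mapP; exists r; rewrite // mem_filter rn.
  near=> t => /ar; rewrite affine_form_segment; apply/eqP.
  by near: t; apply: near_affine_neq0; right; rewrite addrC subrK.
move=> near1; near (0 : R)^'+ => t.
have /Pcov[r rG] : P (t *: x + (1 - t) *: p).
  have t0 : 0 < t by near: t; exact: nbhs_right_gt.
  have t1 : t < 1 by near: t; exact: nbhs_right_lt.
  by move/convex_setP: cP; apply => //; exact: ltW.
suff : forall r : Gamma, ~ Defs.conv [set` val r] (t *: x + (1 - t) *: p).
  by move=> /(_ [` rG]%fset).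
by near: t.
Unshelve. all: by end_near. Qed.

(** * Unimodular simplices *)

Definition floor_mx (R : realType) (n : nat) (v : 'rV[R]_n) : 'rV[int]_n :=
  map_mx Num.floor v.

Lemma floor_mxK (R : realType) (n : nat) (z : 'rV[int]_n) :
  floor_mx (to_real R z) = z.
Proof. by apply/rowP => i; rewrite !mxE intrKfloor. Qed.

Lemma to_real_floor_mx (R : realType) (n : nat) (v : 'rV[R]_n) :
  lattice_point v -> to_real R (floor_mx v) = v.
Proof. by move=> [z ->]; rewrite floor_mxK. Qed.

Lemma map_vertex_mx (R S : nzRingType) (f : {rmorphism R -> S}) (n k : nat)
    (t : nat -> 'rV[R]_n) :
  map_mx f (vertex_mx k t) = vertex_mx k (fun i => map_mx f (t i)).
Proof.
apply/row_matrixP => i; rewrite -map_row !rowK map_row_mx; congr row_mx.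
exact: map_mx1.
Qed.

(** Reduction modulo 2 of a lattice point given by its real coordinates; the
    value at other points is meaningless. *)
Definition reduce2 (R : realType) (n : nat) (v : 'rV[R]_n) : 'rV['F_2]_n :=
  map_mx (intr : int -> 'F_2) (floor_mx v).

Definition unimodular_simplex (R : realType) (n : nat)
    (s : {fset 'rV[R]_n}) : Prop :=
  [/\ #|` s| = n.+1, forall v, v \in s -> lattice_point v &
      vertex_mx (1 + n) (fun i => floor_mx (nth 0 s i)) \in unitmx].

Lemma vertex_mx_floor (R : realType) (n : nat) (s : {fset 'rV[R]_n}) :
  #|` s| = n.+1 -> (forall v, v \in s -> lattice_point v) ->
  vertex_mx (1 + n) (nth 0 s) =
  map_mx (intr : int -> R) (vertex_mx (1 + n) (fun i => floor_mx (nth 0 s i))).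
Proof.
move=> sn ls; rewrite map_vertex_mx; apply/row_matrixP => i; rewrite !rowK.
congr row_mx; symmetry; apply: to_real_floor_mx; apply: ls.
by rewrite mem_nth// sn.
Qed.

(** The volume formula forces an integer determinant to have absolute value
    one. *)
Lemma unimodular_simplexP (R : realType) (n : nat) (s : {fset 'rV[R]_n}) :
  #|` s| = n.+1 -> affinely_independent s ->
  (forall v, v \in s -> lattice_point v) ->
  volume (Defs.conv [set` s]) = ((n`!)%:R^-1)%:E -> unimodular_simplex s.
Proof.
move=> sn ind ls; rewrite conv_simplexE// volume_simplex; first last.
- exact: lsubmx_vertex_mx.
- by rewrite -row_free_unit; exact: row_free_vertex_mx.
move=> [h]; split=> //.
have {h} : `|\det (vertex_mx (1 + n) (nth 0 s))| = 1.
  have f0 : (n`!%:R : R)^-1 != 0 by rewrite invr_eq0 pnatr_eq0 -lt0n fact_gt0.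
  by apply: (mulIf f0); rewrite mul1r.
rewrite vertex_mx_floor// det_map_mx unitmxE.
set d := \det _ => /eqP; rewrite -intr_norm -[1]/(1%:~R) eqr_int.
by rewrite eqr_norml => /andP[/orP[] /eqP -> _]; rewrite ?unitrN1 ?unitr1.
Qed.

(** A lattice point of [conv s] has integral barycentric coordinates with
    respect to [t], supported on [s] and with sum [1].  Hence a functional that
    is constant on the reduced vertices of [s] takes the same value at it. *)
Lemma T2perp_convE (R : realType) (n : nat) (s t : {fset 'rV[R]_n})
    (f : 'Hom('rV['F_2]_n, ('F_2)^o)) :
  unimodular_simplex t -> (s `<=` t)%fset -> 
  T2perp (Defs.conv [set` s]) f <->
  (forall v w, v \in s -> w \in s -> f (reduce2 v) = f (reduce2 w)).
Proof.
move=> [tn ltau ut] st; split=> [fs v w vs ws|fs].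
  apply/eqP; rewrite -subr_eq0 -linearB; apply/eqP; apply: fs.
  exists (floor_mx v - floor_mx w); last by rewrite map_mxB.
  move=> A [_ sA]; apply: sA; exists (floor_mx v), (floor_mx w).
  have inA x : x \in s -> Defs.conv [set` s] (to_real R (floor_mx x)).
    move=> xs; rewrite to_real_floor_mx; first by move=> B [_]; apply.
    by apply: ltau; exact: (fsubsetP st).
  by split=> //; exact: inA.
suff fz z v : Defs.conv [set` s] (to_real R z) -> v \in s ->
    f (map_mx intr z) = f (reduce2 v).
  move=> u [z + <-]; move=> /(_ [set z | f (map_mx intr z) = 0]); apply; split.
    split; first by rewrite /= map_mx0 linear0.
    by move=> x y /= fx fy; rewrite map_mxB linearB/= fx fy subrr.
  move=> _ [x [y [sx sy ->]]] /=; rewrite map_mxB linearB/=.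
  have [s0|[v vs]] := fset_0Vmem s.
    by move/conv_fsetP : sx => [c [_ + _]]; rewrite s0 big_nil => /eqP;
      rewrite eq_sym oner_eq0.
  by rewrite (fz x v)// (fz y v)// subrr.
move=> /conv_fsetP[c [_ c1 cE]] vs.
set Nz := vertex_mx _ _ in ut; set N := vertex_mx (1 + n) (nth 0 t).
pose m := row_mx 1%:M z *m invmx Nz.
pose d v := if v \in s then c v else 0.
have NE : N = map_mx intr Nz by exact: vertex_mx_floor.
have dN : \row_(i < 1 + n) d (nth 0 t i) = map_mx (intr : int -> R) m.
  have uN : N \in unitmx by rewrite unitmxE NE det_map_mx rmorph_unit.
  apply: (can_inj (mulmxK uN)); rewrite {2}NE -map_mxM mulmxKV// map_row_mx.
  rewrite map_mx1 -/(to_real R z) cE -combination_vertex_mx//; last first.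
    rewrite (sum_fset_sub (F := c) st) => [//|w /negPf ws|w ws];
      by rewrite /d ws.
  congr row_mx.
  apply: (sum_fset_sub (G := fun w => d w *: w) st) => w; rewrite /d.
    by move/negPf->; rewrite scale0r.
  by move->.
have m0 i : nth 0 t (i : 'I_(1 + n)) \notin s -> m 0 i = 0.
  move=> /negPf nis; have := congr1 (fun A : 'rV_(1 + n) => A 0 i) dN.
  by rewrite !mxE /d nis => /esym/eqP; rewrite intr_eq0 => /eqP.
have : m *m Nz = row_mx 1%:M z by rewrite mulmxKV.
rewrite mul_vertex_mx => /eq_row_mx[m1 <-].
rewrite map_mx_sum linear_sum/=.
have termE i : f (map_mx intr (m 0 i *: floor_mx (nth 0 t (i : 'I_(1 + n))))) =
    (m 0 i)%:~R *: f (reduce2 v).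
  rewrite map_mxZ linearZ/=; have [is_s|/m0 ->] := boolP (nth 0 t i \in s).
    by congr (_ *: _); exact: fs.
  by rewrite !scale0r.
under eq_bigr do rewrite termE.
rewrite -scaler_suml -rmorph_sum/=.
have -> : \sum_(i < 1 + n) m 0 i = 1.
  by move/matrixP/(_ 0 0): m1; rewrite !mxE !mulr1n.
by rewrite scale1r.
Qed.

(** The vertex matrix is invertible modulo 2, so some affine form has the
    values [e] at the reduced vertices; [f] is its linear part. *)
Lemma unimodular_simplex_functional (R : realType) (n : nat)
    (t : {fset 'rV[R]_n}) (e : 'rV[R]_n -> 'F_2) :
  unimodular_simplex t ->
  exists f : 'Hom('rV['F_2]_n, ('F_2)^o), forall v w, v \in t -> w \in t ->
    f (reduce2 v) - f (reduce2 w) = e v - e w.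
Proof.
move=> [tn _ ut].
pose N := vertex_mx (1 + n) (fun i => reduce2 (nth 0 t i)).
have uN : N \in unitmx.
  rewrite /N /reduce2 -map_vertex_mx unitmxE det_map_mx rmorph_unit//.
pose a := invmx N *m \col_i e (nth 0 t (i : 'I_(1 + n))).
pose g (u : 'rV['F_2]_n) : ('F_2)^o := (u *m dsubmx a) 0 0.
have gL : linear g by move=> k x y; rewrite /g mulmxDl -scalemxAl !mxE.
pose gM := GRing.isLinear.Build _ _ _ _ g gL.
pose gP : {linear _ -> _} := HB.pack g gM.
exists (linfun gP) => v w.
have E x : x \in t -> g (reduce2 x) = e x - usubmx a 0 0.
  move=> xt; have := congr1 (fun A : 'cV_(1 + n) => A (inord (index x t)) 0)
    (mulKVmx uN (\col_i e (nth 0 t (i : 'I_(1 + n))))).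
  have xi : (index x t < 1 + n)%N by rewrite -[X in (_ < X)%N]tn index_mem.
  rewrite -/a => /esym; rewrite mxE inordK// nth_index// => ->.
  set i := inord _.
  have -> : (N *m a) i 0 = (row i (N *m a)) 0 0 by rewrite [RHS]mxE.
  rewrite row_mul rowK inordK// nth_index// -{1}[a]vsubmxK mul_row_col mul1mx.
  by rewrite mxE addrC addrK.
by move=> vt wt; rewrite !lfunE/= !E// opprB addrA subrK.
Qed.

(** * Parity around a simplex *)

Lemma index_rem (T : eqType) (s : seq T) (x u : T) : u != x ->
  index u (rem x s) = (index u s - (index x s < index u s))%N.
Proof.
move=> ux; elim: s => //= y s IH.
have [->|yx] := eqVneq y x; first by rewrite eq_sym (negPf ux) ltn0Sn subn1.
rewrite /=; case: (y == u) => //; rewrite IH ltnS.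
by case: (ltnP (index x s)) => [/(leq_ltn_trans (leq0n _))|]; lia.
Qed.

(** The order in which [L] lists its elements plays the role of the total order
    on the vertices. *)
Definition rank_in (T : choiceType) (L : seq T) (A : {fset T}) (v : T) : nat :=
  index v [seq x <- L | x \in A].

Lemma rank_in_fsetD1 (T : choiceType) (L : seq T) (A : {fset T}) (x u : T) :
  uniq L -> u != x ->
  rank_in L (A `\ x)%fset u =
  (rank_in L A u - (rank_in L A x < rank_in L A u))%N.
Proof.
move=> uL ux; rewrite -index_rem// /rank_in rem_filter ?filter_uniq//.
rewrite -filter_predI; congr (index _ _); apply: eq_filter => y /=.
by rewrite in_fsetD1.
Qed.

Lemma F2_cases (x : 'F_2) : x = 0 \/ x = 1.
Proof. by case: x => -[|[|//]] ?; [left|right]; apply: val_inj. Qed.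

Definition alternates (T : choiceType) (L : seq T) (h : T -> 'F_2)
    (A : {fset T}) : Prop :=
  forall v w, v \in A -> w \in A ->
    h v - h w = (rank_in L A v)%:R - (rank_in L A w)%:R.

(** Here [h] minus the rank is a step function along [A] with its jump at
    position [i]; for [i = 0] and [i = #|A|] it is constant. *)
Definition threshold (T : choiceType) (L : seq T) (h : T -> 'F_2)
    (A : {fset T}) (i : nat) : Prop :=
  exists c, forall v, v \in A ->
    h v - (rank_in L A v)%:R + (i <= rank_in L A v)%N%:R = c.

(** Away from [x] the two threshold conditions both say that [h] alternates on
    [A] minus [x].  They predict values at [x] that differ by [1], and exactly
    one of them is right since [F_2] has two elements; a second element of [A]
    is needed to fix the constant. *)
Lemma alternates_threshold (T : choiceType) (L : seq T) (h : T -> 'F_2)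
    (A : {fset T}) (x : T) :
  uniq L -> {subset A <= L} -> x \in A -> (A `\ x != fset0)%fset ->
  `[< alternates L h (A `\ x)%fset >] =
  `[< threshold L h A (rank_in L A x) >] (+)
  `[< threshold L h A (rank_in L A x).+1 >].
Proof.
move=> uL sAL xA /fset0Pn[y]; rewrite in_fsetD1 => /andP[yx yA].
set r := rank_in L A.
have r_inj u : u \in A -> u != x -> r u != r x.
  move=> uA; apply: contra_neq; rewrite /r /rank_in.
  move=> /(congr1 (nth x [seq z <- L | z \in A])).
  by rewrite !nth_index// mem_filter ?xA ?uA sAL.
have altE : alternates L h (A `\ x)%fset <->
    forall u w, u \in A -> w \in A -> u != x -> w != x ->
    h u - (r u)%:R + (r x < r u)%N%:R = h w - (r w)%:R + (r x < r w)%N%:R.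
  have E u : u != x -> (rank_in L (A `\ x)%fset u)%:R =
      (r u)%:R - (r x < r u)%N%:R :> 'F_2.
    move=> ux; rewrite rank_in_fsetD1// natrB//.
    by case: (ltnP (rank_in L A x)) => // /(leq_ltn_trans (leq0n _)).
  split=> [alt u w uA wA ux wx|alt u w].
    have := alt u w; rewrite !in_fsetD1 ux wx uA wA => /(_ isT isT).
    rewrite !E// => /eqP; rewrite subr_eq => /eqP ->; ring.
  rewrite !in_fsetD1 => /andP[ux uA] /andP[wx wA].
  rewrite !E// -[h u](subrK (r u)%:R) -[h u - _](addrK (r x < r u)%N%:R).
  by rewrite (alt u w)//; ring.
have sle u : u \in A -> u != x -> (r x <= r u)%N = (r x < r u)%N.
  by move=> uA ux; rewrite leq_eqVlt eq_sym (negPf (r_inj _ uA ux)).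
have excl : threshold L h A (r x) -> threshold L h A (r x).+1 -> False.
  move=> [c hc] [d hd].
  have := hc y yA; have := hd y yA; rewrite sle// => -> cd; subst d.
  have := hc x xA; have := hd x xA; rewrite -/r leqnn ltnn => <- /addrI.
  by move/eqP; rewrite mulr1n mulr0n oner_eq0.
have -> : `[< alternates L h (A `\ x)%fset >] =
    `[< threshold L h A (r x) >] || `[< threshold L h A (r x).+1 >].
  rewrite -asbool_or; apply: asbool_equiv_eq; split; last first.
    by move=> [] [c hc]; apply/altE => u w uA wA ux wx;
      have := hc u uA; have := hc w wA; rewrite ?sle// -/r => -> ->.
  move=> /altE alt; pose c := h y - (r y)%:R + (r x < r y)%N%:R.
  have [xc|xc] : h x - (r x)%:R = c \/ h x - (r x)%:R + 1 = c.
    have [] := F2_cases (c - (h x - (r x)%:R)) => /eqP; rewrite subr_eq => /eqP.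
      by rewrite add0r => ->; left.
    by rewrite addrC => ->; right.
  - right; exists c => u uA; have [->|ux] := eqVneq u x.
      by rewrite -/r ltnn addr0.
    exact: alt.
  - left; exists c => u uA; have [->|ux] := eqVneq u x.
      by rewrite -/r leqnn.
    by rewrite -/r sle//; exact: alt.
case: asboolP => [q1|_]; case: asboolP => // q2.
by case: (excl q1 q2).
Qed.

Lemma threshold0 (T : choiceType) (L : seq T) (h : T -> 'F_2) (A : {fset T}) :
  {subset A <= L} -> uniq L ->
  `[< threshold L h A 0 >] = `[< threshold L h A #|` A| >].
Proof.
move=> sAL uL; apply: asbool_equiv_eq.
have rA v : v \in A -> (rank_in L A v < #|` A|)%N.
  move=> vA; rewrite /rank_in [X in (_ < X)%N](_ : _ = size [seq x <- L | x \in A]).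
    by rewrite index_mem mem_filter vA sAL.
  apply: perm_size; apply: uniq_perm; rewrite ?filter_uniq// => v0.
  by rewrite mem_filter; case: (boolP (v0 \in A)) => // /sAL ->.
split=> -[c hc].
  exists (c - 1) => v vA; have := hc v vA; rewrite leq0n leqNgt rA//= => <-.
  by rewrite addr0 addrK.
exists (c + 1) => v vA; have := hc v vA; rewrite leq0n leqNgt rA//= => <-.
by rewrite addr0.
Qed.

(** By [alternates_threshold] the sum telescopes modulo 2, and its two end terms
    agree by [threshold0]. *)
Lemma even_alternates (T : choiceType) (L : seq T) (h : T -> 'F_2)
    (A : {fset T}) :
  uniq L -> {subset A <= L} -> (1 < #|` A|)%N ->
  ~~ odd (\sum_(v <- A) `[< alternates L h (A `\ v)%fset >])%N.
Proof.
move=> uL sAL A1; pose t := [seq x <- L | x \in A].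
have uT : uniq t by rewrite filter_uniq.
have At : perm_eq A t.
  apply: uniq_perm => // v; rewrite mem_filter.
  by case: (boolP (v \in A)) => // /sAL ->.
have [x0 x0A] : exists x, x \in A.
  by apply/fset0Pn; rewrite -cardfs_eq0 -lt0n (ltn_trans _ A1).
have tA : size t = #|` A| by rewrite (perm_size At).
pose Q i := `[< threshold L h A i >].
have E i : (i < size t)%N ->
    `[< alternates L h (A `\ nth x0 t i)%fset >] = Q i (+) Q i.+1.
  move=> it; have tiA : nth x0 t i \in A by rewrite (perm_mem At) mem_nth.
  rewrite alternates_threshold//; first by rewrite /Q /rank_in index_uniq.
  by rewrite -cardfs_eq0; have := cardfsD1 (nth x0 t i) A; rewrite tiA; lia.
rewrite (perm_big _ At)/= (big_nth x0) big_mkord.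
under eq_bigr => i _ do rewrite E//.
have -> k : odd (\sum_(i < k) (Q i (+) Q i.+1))%N = Q 0 (+) Q k.
  elim: k => [|k IH]; first by rewrite big_ord0 addbb.
  rewrite big_ord_recr/= oddD IH oddb addbA; congr (_ (+) _).
  by rewrite -addbA addbb addbF.
by rewrite tA /Q threshold0// addbb.
Qed.

(** * Existence of real phase structures *)

Lemma card_faces (R : realType) (n k : nat) (t : {fset 'rV[R]_n})
    (P : pred {fset 'rV[R]_n}) : #|` t| = k.+2 ->
  #|` [fset s in faces k t | P s]%fset| =
  (\sum_(v <- t) P (t `\ v)%fset)%N.
Proof.
move=> tk.
have -> : [fset s in faces k t | P s]%fset =
    [fset (t `\ v)%fset | v in [fset v in t | P (t `\ v)%fset]%fset]%fset.
  apply/fsetP => s; apply/idP/imfsetP => /=.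
    rewrite !inE/= fpowersetE => /andP[/andP[st /eqP sk] Ps].
    have : #|` (t `\` s)%fset| == 1.
      by rewrite cardfsD (fsetIidPr st) tk sk subSn// subnn.
    move=> /cardfs1P[v vE]; have vD : v \in (t `\` s)%fset by rewrite vE inE.
    have sE : s = (t `\ v)%fset by rewrite -vE fsetDDr fsetDv fset0U (fsetIidPr st).
    move: vD; rewrite in_fsetD => /andP[_ vt].
    by exists v => //; rewrite !inE/= vt -sE.
  move=> [v]; rewrite !inE/= => /andP[vt Pv] ->; rewrite Pv andbT.
  rewrite fpowersetE fsubD1set//=; have := cardfsD1 v t; rewrite vt tk.
  by move=> /eqP; rewrite add1n eqSS eq_sym.
rewrite card_in_imfset/=; last first.
  move=> v w; rewrite !inE/= => /andP[vt _] /andP[wt _] E.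
  apply/eqP; apply: contraT => vw; have : v \in (t `\ w)%fset.
    by rewrite in_fsetD1 vw.
  by rewrite -E in_fsetD1 eqxx.
rewrite -[size _]/(#|` [fset v in t | P (t `\ v)%fset]%fset|) card_fset_sum1.
by rewrite -big_fset_condE/= big_mkcond/=; apply: eq_bigr => v _; case: (P _).
Qed.

Lemma convex_conv (R : realType) (n : nat) (A : set 'rV[R]_n) :
  convex_set (Defs.conv A : set (convex_lmodType 'rV[R]_n)).
Proof.
apply/convex_setP => x y t t0 t1 Ax Ay B [cB AB].
by move/convex_setP: (cB); apply => //; [exact: Ax|exact: Ay].
Qed.

Lemma sub_unimodular_simplex (R : realType) (n : nat) (Delta : set 'rV[R]_n)
    (Gamma : {fset {fset 'rV[R]_n}}) (s : {fset 'rV[R]_n}) :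
  convex_set (Delta : set (convex_lmodType 'rV[R]_n)) ->
  has_dimension Delta n -> unimodular_triangulation Delta Gamma ->
  s \in Gamma -> exists2 t, unimodular_simplex t & (s `<=` t)%fset.
Proof.
move=> cD dimD [tr lat vol] sG.
have [t tn st] := triangulation_pure cD dimD tr sG; exists t => //.
have /andP[tG /eqP card_t] : (t \in Gamma) && (#|` t| == n.+1).
  by move: tn; rewrite !inE.
apply: unimodular_simplexP => //; last exact: vol.
  exact: (triangulation_simplex tr).
by move=> v; exact: lat tG.
Qed.

Theorem theorem1p7 (R : realType) (n : nat) (Delta : set 'rV[R]_n)
    (Gamma : {fset {fset 'rV[R]_n}})
    (Q : affineSpace 'Hom('rV['F_2]_n, ('F_2)^o)) (k : nat)
    (hDelta : lattice_polytope Delta) (hsmooth : smooth Delta)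
    (hGamma : unimodular_triangulation Delta Gamma) (hk : (k <= n)%N) :
  exists E : {fset 'rV[R]_n} -> set Q, real_phase_structure k Gamma E.
Proof.
have [[V DeltaE] dimD _] := hDelta.
have cD : convex_set (Delta : set (convex_lmodType 'rV[R]_n)).
  by rewrite DeltaE; exact: convex_conv.
(* The choice of a base point [q0] identifies [Q] with the dual space. *)
have [q0] := affine_inhabited Q.
pose L := enum_fset (\bigcup_(s <- Gamma) s)%fset.
have uL : uniq L by exact: fset_uniq.
have GL s : s \in Gamma -> {subset s <= L}.
  by move=> sG v vs; apply/bigfcupP; exists s; rewrite ?sG.
pose g (f : 'Hom('rV['F_2]_n, ('F_2)^o)) (v : 'rV[R]_n) : 'F_2 := f (reduce2 v).
exists (fun s => [set translate q0 f | f in [set f | alternates L (g f) s]]).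
split=> [s|t].
  rewrite !inE/= => /andP[sG _].
  have [t ut st] := sub_unimodular_simplex cD dimD hGamma sG.
  have [f0 f0E] := unimodular_simplex_functional
    (fun v => (rank_in L s v)%:R) ut.
  have f0s v w : v \in s -> w \in s -> g f0 v - g f0 w =
      (rank_in L s v)%:R - (rank_in L s w)%:R.
    by move=> vs ws; apply: f0E; exact: (fsubsetP st).
  exists (translate q0 f0); apply/seteqP; split=> _ [f fs <-].
    exists (f - f0); last by rewrite -translateD addrC subrK.
    apply/(T2perp_convE _ ut st) => v w vs ws.
    rewrite !lfunE/= !lfunE/=; apply/eqP; rewrite -subr_eq0.
    have := fs v w vs ws; rewrite -f0s// /g => /eqP; rewrite -subr_eq0.
    congr (_ == _); ring.
  exists (f0 + f); last by rewrite translateD.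
  move=> v w vs ws; rewrite /g !lfunE/= -f0s// /g.
  by rewrite (proj1 (T2perp_convE _ ut st) fs v w vs ws); ring.
rewrite !inE/= => /andP[tG /eqP tk] s.
have [f [sE f_uniq]] := translate_simply_transitive q0 s.
rewrite (card_faces _ tk).
rewrite (eq_bigr (fun v => nat_of_bool `[< alternates L (g f) (t `\ v)%fset >])).
  by apply: even_alternates; [|exact: GL|rewrite tk].
move=> v _; congr nat_of_bool; apply/idP/asboolP; rewrite inE/=.
  by move=> [f' altf' sE']; rewrite (f_uniq f').
by move=> altf; exists f.
Qed.
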